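(* Let $K$ be a number field with ring of integers $O_K$. Let $f(x)=x^d+c_1/c_2$, $d\ge2$, where $c_1,c_2\in O_K$ are relatively prime in $O_K$, and let $u_1/u_2$ be a periodic point of $f(x)$ of exact period $n>1$, where $u_1,u_2\in O_K$ are relatively prime in $O_K$. Let $F_0=c_2^{d^{n-1}}f^n(0)$. The following statements hold. (a) If $p$ is a prime of $O_K$ such that $\nu_p(u_1)=a$ with $a\geq 1$, then $\nu_p(F_0)=a$. In particular, $u_1\parallel F_0$. (b) $c_1$ and $u_1$ are relatively prime in $O_K$. (c) $u_1\parallel \frac{F_0}{c_1}$; and $\frac{F_0}{c_1}$ and $c_1$ are relatively prime in $O_K$. (d) $c_1\mid (u_1^{d^n-1}-u_2^{d^n-1})$.
   Context: The iterates of $f$ are $f^1=f$ and $f^m(x)=f(f^{m-1}(x))$ for $m\ge 2$. A point $u\in K$ is a periodic point of exact period $n$ if $n$ is the smallest positive integer with $f^n(u)=u$. $\nu_p$ is the valuation of $K$ at $p$. The notation $u_1\parallel y$ means that $u_1$ exactly divides $y$: $\nu_p(y)=\nu_p(u_1)$ for every prime $p$ dividing $u_1$. The quantity $F_0$ is the value at $(c_1,c_2)$ of a polynomial with integer coefficients divisible by its first variable, so $F_0\in c_1\mathbb{Z}[c_1,c_2]$ and $F_0/c_1\in O_K$. The denominators $c_2,u_2$ are considered modulo units of $O_K$. *)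

(* Defs.v *)
From HB Require Import structures.
From mathcomp Require Import all_boot all_order all_algebra all_field.
From mathcomp Require Import boolp classical_sets constructive_ereal.

Set Implicit Arguments.
Unset Strict Implicit.
Unset Printing Implicit Defensive.

Import Order.TTheory GRing.Theory Num.Theory.

Local Open Scope ring_scope.

Section RingOfIntegers.
Variable K : fieldExtType rat.

Definition algint : {pred K} :=
  fun x => `[< integralOver (intr : int -> K) x >].

Fact algint_subring_closed : subring_closed algint.
Proof.
split=> [|x y|x y]; rewrite !unfold_in.
- exact/asboolP/(integral1 (intr : {rmorphism int -> K})).
- move=> /asboolP xI /asboolP yI.
  exact/asboolP/(integral_sub (RtoK := (intr : {rmorphism int -> K}))).
- move=> /asboolP xI /asboolP yI.
  exact/asboolP/(integral_mul (RtoK := (intr : {rmorphism int -> K}))).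
Qed.

HB.instance Definition _ :=
  GRing.isSubringClosed.Build K algint algint_subring_closed.

Record ring_of_integers := RingOfIntegers {
  algint_val : K;
  algint_valP : algint_val \in algint }.

HB.instance Definition _ := [isSub for algint_val].
HB.instance Definition _ := [Choice of ring_of_integers by <:].
HB.instance Definition _ := [SubChoice_isSubComNzRing of ring_of_integers by <:].

End RingOfIntegers.

Notation "''O_' K" := (ring_of_integers K)
  (at level 8, K at level 2, format "''O_' K") : type_scope.

Section Ideals.
Variable R : comNzRingType.

Definition relatively_prime (x y : R) := exists a b : R, a * x + b * y = 1.

Definition divides (x y : R) := exists q : R, y = q * x.

Definition ideal_mul (I J : set R) : set R :=
  [set x | exists2 s : seq (R * R),
     (forall ab, ab \in s -> I ab.1 /\ J ab.2) &
     x = \sum_(ab <- s) ab.1 * ab.2]%classic.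

Definition ideal_exp (I : set R) (k : nat) : set R :=
  iter k (ideal_mul I) setT.

End Ideals.

Section Valuation.
Variable K : fieldExtType rat.
Implicit Types (p : {pred 'O_K}) (x y : K).

(* [idealr_closed] includes [1 \notin p], so p is proper. *)
Definition prime_of p :=
  [/\ idealr_closed p, prime_idealr_closed p & exists2 x, x \in p & x != 0].

(* The fractional ideal p^m; for m < 0 it is the colon (O_K : p^(-m)). *)
Definition ideal_expz p (m : int) : set K :=
  match m with
  | Posz k => [set val z | z in ideal_exp [set` p] k]
  | Negz k => [set y | forall z, ideal_exp [set` p] k.+1 z ->
                         y * val z \in @algint K]
  end%classic.

(* The fractional ideal p^m O_(p) of the localization at p, that is, the set *)
(* of the x in K whose valuation at p is at least m.                         *)
Definition local_expz p (m : int) : set K :=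
  [set x | exists2 s : 'O_K, s \notin p & ideal_expz p m (val s * x)]%classic.

(* The p-adic valuation of K, with value +oo at 0. *)
Definition valuation p x : \bar int :=
  supremum -oo%E [set m%:E | m in [set m : int | local_expz p m x]]%classic.

Definition exactly_divides (u : 'O_K) (y : K) :=
  forall p, prime_of p -> u \in p -> valuation p y = valuation p (val u).

End Valuation.

Section Dynamics.
Variable F : fieldType.

Definition unicritical (d : nat) (c : F) : F -> F := fun x => x ^+ d + c.

Definition exact_period (f : F -> F) (n : nat) (u : F) :=
  [/\ (0 < n)%N, iter n f u = u &
      forall m, (0 < m < n)%N -> iter m f u != u].

Definition F0 (d n : nat) (c1 c2 : F) : F :=
  c2 ^+ (d ^ n.-1) * iter n (unicritical d (c1 / c2)) 0.

End Dynamics.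

(* F_0 / c_1 as the value at (c_1, c_2) of a polynomial with coefficients in *)
(* int, which makes sense in 'O_K, and also for c_1 = 0. See [val_F0_quot].  *)
Fixpoint F0_quot (R : comNzRingType) (d n : nat) (c1 c2 : R) : R :=
  if n is m.+1 then
    c1 ^+ d.-1 * F0_quot d m c1 c2 ^+ d + c2 ^+ (d ^ m).-1
  else 0.

Lemma F0_quotE (F : fieldType) (d n : nat) (c1 c2 : F) :
  (0 < d)%N -> (0 < n)%N -> c2 != 0 -> F0 d n c1 c2 = c1 * F0_quot d n c1 c2.
Proof.
case: n => // n d_gt0 _ c2N0; rewrite /F0 /=.
elim: n => [|n IHn].
  by rewrite /unicritical /= !expr0n gtn_eqF // mulr0
    !add0r !expn0 expr1 mulr1 mulrC divfK.
have dn_gt0 : (0 < d ^ n.+1)%N by rewrite expn_gt0 d_gt0.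
rewrite [iter _ _ _]/= {1}/unicritical mulrDr [F0_quot _ n.+1 _ _]/= mulrDr.
congr (_ + _); last by rewrite -{1}(prednK dn_gt0) exprSr mulrCA mulfK.
by rewrite /= expnSr exprM -exprMn IHn exprMn mulrA -exprS prednK.
Qed.

Lemma F0_quot_morph (R S : comNzRingType) (h : {rmorphism R -> S})
    (d n : nat) (c1 c2 : R) :
  h (F0_quot d n c1 c2) = F0_quot d n (h c1) (h c2).
Proof.
by elim: n => [|n IHn] /=; rewrite ?rmorph0 // rmorphD rmorphM !rmorphXn /= IHn.
Qed.

Lemma val_F0_quot (K : fieldExtType rat) (d n : nat) (c1 c2 : 'O_K) :
  (0 < d)%N -> (0 < n)%N -> c1 != 0 -> c2 != 0 ->
  val (F0_quot d n c1 c2) = F0 d n (val c1) (val c2) / val c1.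
Proof.
have val_neq0 (x : 'O_K) : x != 0 -> val x != 0.
  by apply: contra_neq => vx0; apply: val_inj; rewrite vx0 rmorph0.
move=> d_gt0 n_gt0 /val_neq0 c1N0 /val_neq0 c2N0.
rewrite F0_quotE // mulrAC divff // mul1r.
exact: (F0_quot_morph (val : {rmorphism 'O_K -> K})).
Qed.

(* Main.v *)
Require Import Defs.
From HB Require Import structures.
From mathcomp Require Import all_boot all_order all_algebra all_field.
From mathcomp Require Import boolp classical_sets constructive_ereal.
From mathcomp Require Import ring.

(** Everything is read off the numerators of the iterates, by divisibility and
    comaximality alone, without unique factorization of ideals.

    Put e = d^(n-1) and D = d^n.  Over the denominator c2^e u2^D the point
    f^n(u1/u2) has a numerator N that is a polynomial in c1, c2, u1, u2, so
    periodicity reads N = c2^e u2^(D-1) u1.  The polynomial N satisfies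

      - N = c2^e u1^D  modulo  c1 u2^d      ([iter_num_mod_c1y]),
      - N = (c1 u2^d)^e  modulo  c2         ([iter_num_mod_c2]),
      - N = F_0 u2^D  modulo  u1^d          ([iter_num_mod_x]),

    the last one because f^n(x) is a polynomial in x^d and N is F_0 at the
    point 0/1.  The first two show that u2 divides a power of c2 and c2 a power
    of u2, which replaces the assertion that c2 and u2^d are associated; hence
    u2 is comaximal to c1, and c2 to u1.

    (a) The third congruence gives F_0 u2^D = u1 (c2^e u2^(D-1) - q u1^(d-1)).
    At a prime p containing u1 both cofactors of F_0 and u1 lie outside p, as
    d > 1, and two elements that agree up to factors outside p have the same
    valuation ([valuation_cross]).

    (b) If c1 and u1 had a common prime, f would contract p-adically near the
    orbit, which forbids a cycle of length n > 1.  In the form of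
    [periodic_subring1] this needs no prime: differences of consecutive orbit
    points are multiplied along the cycle by elements of any nonunital subring
    containing c1/c2 and u1/u2, and return to their nonzero initial value, so
    that the subring contains 1.  For the ideal generated by c1 and u1 after
    inverting c2 u2, this means that a power of c2 u2 lies in that ideal; but
    c2 u2 is comaximal to c1.

    (c) F_0 / c1 is congruent to a power of c2 modulo c1, hence comaximal to
    c1, and c1 does not affect valuations at primes containing u1 by (b).

    (d) The first congruence says that c1 divides
    c2^e u1 (u1^(D-1) - u2^(D-1)), and c1 is comaximal to c2 and u1. *)

Set Implicit Arguments.
Unset Strict Implicit.
Unset Printing Implicit Defensive.

Import Order.TTheory GRing.Theory Num.Theory.

Local Open Scope ring_scope.

(** * Divisibility and comaximality in a commutative ring *)

Section Comaximal.
Variable R : comNzRingType.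
Implicit Types x y z g : R.

Lemma divides_mull g x y : divides g y -> divides g (x * y).
Proof. by case=> q ->; exists (x * q); rewrite mulrA. Qed.

Lemma dividesD g x y : divides g x -> divides g y -> divides g (x + y).
Proof. by case=> q -> [r ->]; exists (q + r); rewrite mulrDl. Qed.

Lemma divides_subX g x y k : divides g (x - y) -> divides g (x ^+ k - y ^+ k).
Proof. by move=> gxy; rewrite subrXX mulrC; apply: divides_mull. Qed.

Lemma divides_exp x k : (0 < k)%N -> divides x (x ^+ k).
Proof. by case: k => // k _; exists (x ^+ k); rewrite exprSr. Qed.

Lemma relatively_primeC x y : relatively_prime x y -> relatively_prime y x.
Proof. by case=> a [b ab1]; exists b, a; rewrite addrC. Qed.

Lemma relatively_primeM x y z :
  relatively_prime x y -> relatively_prime x z -> relatively_prime x (y * z).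
Proof.
move=> [a [b ab1]] [a' [b' ab1']].
exists (a * a' * x + a * b' * z + b * y * a'), (b * b').
by rewrite -[1]mulr1 -{1}ab1 -ab1'; ring.
Qed.

Lemma relatively_primeX x y k :
  relatively_prime x y -> relatively_prime x (y ^+ k).
Proof.
move=> xy; elim: k => [|k IHk]; last by rewrite exprS; apply: relatively_primeM.
by exists 0, 1; rewrite mul0r add0r mulr1.
Qed.

Lemma relatively_prime_dvdr x y z :
  divides y z -> relatively_prime x z -> relatively_prime x y.
Proof. by move=> [q ->] [a [b ab1]]; exists a, (b * q); rewrite -mulrA. Qed.

Lemma relatively_prime_subl x y z :
  divides y (x - z) -> relatively_prime y z -> relatively_prime y x.
Proof.
move=> [q /eqP]; rewrite subr_eq => /eqP -> [a [b ab1]].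
by exists (a - b * q), b; rewrite -ab1; ring.
Qed.

Lemma Gauss_divides x y z :
  relatively_prime x y -> divides x (y * z) -> divides x z.
Proof.
move=> [a [b ab1]] [q yzE]; exists (a * z + b * q).
by rewrite -[LHS]mul1r -ab1 mulrDl -[b * y * z]mulrA yzE; ring.
Qed.

End Comaximal.

(** * Numerators of the iterates *)

Section IterNum.
Variables (R : comNzRingType) (d : nat) (c1 c2 : R).
Hypothesis d_gt1 : (1 < d)%N.
Implicit Types (x y : R) (m : nat).

(** The numerator of the iterate of order m.+1 of [unicritical d (c1 / c2)] at
    [x / y] over the denominator [c2 ^+ (d ^ m) * y ^+ (d ^ m.+1)]; see
    [iter_unicritical].  The shift by one avoids the exponent 1/d that [c2]
    would have in the denominator of the iterate of order 0. *)
Fixpoint iter_num x y m : R :=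
  if m is m'.+1 then
    iter_num x y m' ^+ d + c1 * c2 ^+ (d ^ m).-1 * y ^+ (d ^ m.+1)
  else c2 * x ^+ d + c1 * y ^+ d.

Let d_gt0 : (0 < d)%N := ltnW d_gt1.

(** Dropping the constant term of f, which carries both [c1] and a power of
    [y] in the numerator, leaves the iteration of x |-> x^d.  One congruence
    thus serves both moduli [c1] and [y]. *)
Lemma iter_num_mod_c1y x y m :
  divides (c1 * y ^+ d) (iter_num x y m - c2 ^+ (d ^ m) * x ^+ (d ^ m.+1)).
Proof.
elim: m => [|m IHm] /=; first by exists 1; rewrite expn0 !expn1; ring.
have -> : c2 ^+ (d ^ m.+1) * x ^+ (d ^ m.+2)
    = (c2 ^+ (d ^ m) * x ^+ (d ^ m.+1)) ^+ d.
  by rewrite exprMn -!exprM -!expnSr.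
rewrite addrAC; apply: dividesD; first exact: divides_subX.
exists (c2 ^+ (d ^ m.+1).-1 * y ^+ (d * (d ^ m.+1).-1)).
have -> : (d ^ m.+2 = d * (d ^ m.+1).-1 + d)%N.
  by rewrite addnC -mulnS prednK -?expnS // expn_gt0 d_gt0.
by rewrite exprD; ring.
Qed.

(** Only the first step contributes a constant term prime to [c2]: afterwards
    its factor [c2 ^+ (d ^ m).-1] has a positive exponent. *)
Lemma iter_num_mod_c2 x y m :
  divides c2 (iter_num x y m - (c1 * y ^+ d) ^+ (d ^ m)).
Proof.
elim: m => [|m IHm] /=.
  by exists (x ^+ d); rewrite expn0 expr1 addrK mulrC.
rewrite {2}expnSr [X in _ - X]exprM.
rewrite addrAC; apply: dividesD; first exact: divides_subX.
rewrite mulrAC; apply/divides_mull/divides_exp.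
by rewrite -subn1 subn_gt0 -{1}(expn0 d) ltn_exp2l.
Qed.

(** An iterate of f is a polynomial in x^d, so modulo x^d it may be evaluated
    at 0. *)
Lemma iter_num_mod_x x y m :
  divides (x ^+ d) (iter_num x y m - iter_num 0 1 m * y ^+ (d ^ m.+1)).
Proof.
elim: m => [|m IHm] /=.
  exists c2; rewrite expn1 expr0n gtn_eqF // expr1n.
  by rewrite mulr0 add0r mulr1 addrK.
rewrite expr1n mulr1 mulrDl opprD addrACA subrr addr0.
by rewrite {1}expnSr exprM -exprMn; apply: divides_subX.
Qed.

End IterNum.

Lemma iter_num_morph (R S : comNzRingType) (h : {rmorphism R -> S})
    (d : nat) (c1 c2 x y : R) m :
  h (iter_num d c1 c2 x y m) = iter_num d (h c1) (h c2) (h x) (h y) m.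
Proof.
by elim: m => [|m IHm] /=; rewrite !(rmorphD, rmorphM, rmorphXn) /= ?IHm.
Qed.

Lemma iter_unicritical (F : fieldType) (d : nat) (c1 c2 x y : F) m :
  (0 < d)%N -> c2 != 0 -> y != 0 ->
  c2 ^+ (d ^ m) * y ^+ (d ^ m.+1) * iter m.+1 (unicritical d (c1 / c2)) (x / y)
    = iter_num d c1 c2 x y m.
Proof.
move=> d_gt0 c2N0 yN0; elim: m => [|m IHm].
  rewrite /= /unicritical expn0 expn1 expr1 expr_div_n.
  by field; rewrite c2N0 expf_neq0.
rewrite [iter _ _ _]/= [in LHS]/unicritical -/(iter m.+1 _ _) /= -IHm.
rewrite mulrDr !exprMn -!exprM -!expnSr; congr (_ + _).
have dm_gt0 : (0 < d ^ m.+1)%N by rewrite expn_gt0 d_gt0.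
by rewrite -{1}(prednK dm_gt0) exprS; field.
Qed.

(** * Attraction towards a nonunital subring *)

(** The set [A] plays the role of an ideal of points attracted to each other:
    f x - f y is x - y times an element of [A].  Going once around the cycle
    multiplies the nonzero difference f u - u by some t in [A] and gives it
    back, so t = 1.  The condition d > 1 is what puts the factor in [A], as
    all the terms of (x^d - y^d) / (x - y) have positive degree. *)
Lemma periodic_subring1 (F : fieldType) (A : F -> Prop) (d n : nat) (c u : F) :
  (forall x y, A x -> A y -> A (x + y)) ->
  (forall x y, A x -> A y -> A (x * y)) ->
  (1 < d)%N -> (1 < n)%N -> A c -> A u ->
  exact_period (unicritical d c) n u -> A 1.
Proof.
move=> AD AM d_gt1 n_gt1 Ac Au [_ fnu fu_neq].
set f := unicritical d c in fnu fu_neq.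
have AX x k : A x -> A (x ^+ k.+1).
  by move=> Ax; elim: k => // k IHk; rewrite exprS; apply: AM.
have Af x : A x -> A (f x).
  by move=> Ax; apply: AD => //; rewrite -(prednK (ltnW d_gt1)); apply: AX.
have Ai i : A (iter i f u) by elim: i => //= i; apply: Af.
have powB k x y : A x -> A y ->
    exists2 t, A t & x ^+ k.+2 - y ^+ k.+2 = (x - y) * t.
  move=> Ax Ay; elim: k => [|k [t At tE]].
    by exists (x + y); [apply: AD | rewrite subr_sqr].
  exists (x * t + y ^+ k.+2); first by apply: AD; [apply: AM | apply: AX].
  by rewrite mulrDr mulrCA -tE !exprS; ring.
have contract x y : A x -> A y -> exists2 t, A t & f x - f y = (x - y) * t.
  move=> Ax Ay; rewrite /f /unicritical opprD addrACA subrr addr0.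
  by rewrite -(subnK d_gt1) addn2; apply: powB.
have [t At tE] : exists2 t, A t & iter n f (f u) - iter n f u = (f u - u) * t.
  case: n n_gt1 {fnu fu_neq} => // n _; elim: n => [|n [t At IHn]].
    by apply: contract; last exact: Au; apply: Af.
  have AiS : A (iter n.+1 f (f u)) by rewrite -iterSr; apply: Ai.
  have [s As sE] := contract _ _ AiS (Ai n.+1).
  by exists (t * s); [apply: AM | rewrite mulrA -IHn].
have fuN0 : f u - u != 0 by rewrite subr_eq0 (fu_neq 1%N).
suff <- : t = 1 by [].
by apply: (mulfI fuN0); rewrite mulr1 -tE -iterSr iterS fnu.
Qed.

(** * Valuations *)

(* Simplification turns [val] into [algint_val], which the morphism lemmas *)
(* must then recognize as well. *)
HB.instance Definition _ (K : fieldExtType rat) :=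
  GRing.RMorphism.copy (@algint_val K) (val : 'O_K -> K).

Section PrimeIdeal.
Variables (K : fieldExtType rat) (p : {pred 'O_K}).
Hypothesis p_prime : prime_of p.
Implicit Types (x y : K) (m : int) (s t a z : 'O_K).

Lemma prime_mulN s t : s \notin p -> t \notin p -> s * t \notin p.
Proof.
move=> sNp tNp; have [_ pP _] := p_prime.
by apply/negP => /pP; rewrite (negPf sNp) (negPf tNp).
Qed.

Lemma prime_expN s k : s \notin p -> s ^+ k \notin p.
Proof.
move=> sNp; elim: k => [|k IHk]; last by rewrite exprS prime_mulN.
by have [[]] := p_prime.
Qed.

Lemma prime_addl a z t : z \in p -> t \in p -> a * z + t \in p.
Proof. by have [[_ _ pD] _ _] := p_prime; apply: pD. Qed.

Lemma prime_mull a z : z \in p -> a * z \in p.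
Proof.
have [[p0 _ _] _ _] := p_prime.
by move=> zp; rewrite -[a * z]addr0 prime_addl.
Qed.

Lemma relatively_prime_notin z t :
  relatively_prime z t -> z \in p -> t \notin p.
Proof.
move=> [a [b ab1]] zp; have [[_ p1 _] _ _] := p_prime.
apply: contra p1 => tp; rewrite -ab1; apply: prime_addl => //.
exact: prime_mull.
Qed.

Lemma ideal_exp_mull k a z :
  ideal_exp [set` p]%classic k z -> ideal_exp [set` p]%classic k (a * z).
Proof.
case: k => // k [s sP ->].
exists [seq (a * ab.1, ab.2) | ab <- s].
  by move=> _ /mapP[ab /sP[ab1 ab2] ->]; split=> //=; apply: prime_mull.
by rewrite big_map mulr_sumr; apply: eq_bigr => ab _; rewrite mulrA.
Qed.

Lemma ideal_exp_sub k z : ideal_exp [set` p]%classic k.+1 z -> z \in p.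
Proof.
move=> [s sP ->]; have [[p0 _ _] _ _] := p_prime.
rewrite big_seq; elim/big_ind: _ => // [x y xp yp|ab /sP[ab1 _]].
  by rewrite -[x]mul1r prime_addl.
by rewrite mulrC prime_mull.
Qed.

Lemma ideal_expz_mull m a x :
  ideal_expz p m x -> ideal_expz p m (val a * x).
Proof.
case: m => k /=.
  by move=> [z zk <-]; exists (a * z); rewrite ?rmorphM //; apply: ideal_exp_mull.
by move=> xP z /xP xz; rewrite -mulrA rpredM //; apply: valP.
Qed.

Lemma local_expz_cross s t x y m :
  s \notin p -> val s * y = val t * x -> local_expz p m x -> local_expz p m y.
Proof.
move=> sNp styx [r rNp rx]; exists (r * s); first exact: prime_mulN.
by rewrite rmorphM -mulrA styx mulrCA; apply: ideal_expz_mull.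
Qed.

(** Factors outside [p] are absorbed by the localization in [local_expz], so
    that both valuations are suprema of the same set. *)
Lemma valuation_cross s t x y :
  s \notin p -> t \notin p -> val s * y = val t * x ->
  valuation p y = valuation p x.
Proof.
move=> sNp tNp styx; rewrite /valuation.
congr (supremum _ [set _ | _ in _]%classic).
apply/seteqP; split=> m; last exact: (local_expz_cross sNp styx).
by apply: (local_expz_cross tNp (esym styx)).
Qed.

(** For [z] outside [p] the set defining its valuation has the upper bound 0,
    since [s * z] in p^(k+1) would put [s * z] in [p]. *)
Lemma valuation_ge1 (z : 'O_K) : (1%:E <= valuation p (val z))%E -> z \in p.
Proof.
apply: contraTT => zNp; rewrite -ltNge.
have ub0 : ubound [set m%:E | m in [set m | local_expz p m (val z)]]%classic 0%E.
  move=> _ [[k|k] [s sNp sz] <-] //; rewrite lee_fin.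
  case: k sz => // k [r /ideal_exp_sub rp]; rewrite -rmorphM => /val_inj rE.
  by have := prime_mulN sNp zNp; rewrite -rE rp.
apply: (@le_lt_trans _ _ 0%E) => //.
(* The default value -oo of the supremum also satisfies the bound. *)
rewrite /valuation /supremum; case: ifP => // _; case: xgetP => [y -> [_ yP]|//].
exact: yP.
Qed.

End PrimeIdeal.

(** * Periodic points *)

Section PeriodicPoint.
Variables (K : fieldExtType rat) (d n : nat) (c1 c2 u1 u2 : 'O_K).
Hypotheses (d_gt1 : (1 < d)%N) (n_gt1 : (1 < n)%N).
Hypotheses (c2N0 : c2 != 0) (c12 : relatively_prime c1 c2).
Hypotheses (u2N0 : u2 != 0) (u12 : relatively_prime u1 u2).
Hypothesis per_u :
  exact_period (unicritical d (val c1 / val c2)) n (val u1 / val u2).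

Let d_gt0 : (0 < d)%N := ltnW d_gt1.
Let n_gt0 : (0 < n)%N := ltnW n_gt1.
Let dn_gt0 : (0 < d ^ n)%N. Proof. by rewrite expn_gt0 d_gt0. Qed.

Let val_neq0 (x : 'O_K) : x != 0 -> val x != 0.
Proof. by apply: contra_neq => vx0; apply: val_inj; rewrite vx0 rmorph0. Qed.

Lemma iter_num_periodic :
  iter_num d c1 c2 u1 u2 n.-1
    = c2 ^+ (d ^ n.-1) * u2 ^+ (d ^ n).-1 * u1.
Proof.
have [_ fnu _] := per_u; apply: val_inj.
have := iter_unicritical (val c1) (val u1) n.-1 d_gt0 (val_neq0 c2N0)
  (val_neq0 u2N0).
rewrite prednK // fnu (iter_num_morph (val : {rmorphism 'O_K -> K})) => <-.
rewrite !rmorphM !rmorphXn /= -{1}(prednK dn_gt0) exprSr.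
by field; rewrite val_neq0.
Qed.

Lemma F0_iter_num :
  F0 d n (val c1) (val c2) = val (iter_num d c1 c2 0 1 n.-1).
Proof.
rewrite (iter_num_morph (val : {rmorphism 'O_K -> K})) rmorph0 rmorph1.
rewrite -(iter_unicritical _ 0 n.-1 d_gt0 (val_neq0 c2N0) (oner_neq0 K)).
by rewrite expr1n mulr1 mul0r prednK.
Qed.

Lemma val_mul_F0_quot :
  F0 d n (val c1) (val c2) = val (c1 * F0_quot d n c1 c2).
Proof.
rewrite (F0_quotE _ d_gt0 n_gt0 (val_neq0 c2N0)).
by rewrite -(F0_quot_morph (val : {rmorphism 'O_K -> K})) -rmorphM.
Qed.

(** The two formulas for the numerator leave [c2 ^+ _ * u1 ^+ _] divisible by
    [u2], and [u1] can be cancelled. *)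
Lemma u2_dvd_c2_exp : divides u2 (c2 ^+ (d ^ n.-1)).
Proof.
apply: (@Gauss_divides _ _ (u1 ^+ (d ^ n))).
  exact/relatively_primeX/relatively_primeC.
have [q] := iter_num_mod_c1y c1 c2 d_gt1 u1 u2 n.-1.
rewrite prednK // iter_num_periodic => /eqP; rewrite subr_eq addrC -subr_eq.
move=> /eqP /esym; rewrite mulrC => ->.
have d1 : (0 < (d ^ n).-1)%N.
  by rewrite -subn1 subn_gt0 -{1}(expn0 d) ltn_exp2l.
rewrite -mulNr; apply: dividesD.
  by rewrite mulrAC; apply/divides_mull/divides_exp.
by do 2! apply: divides_mull; apply: divides_exp.
Qed.

Lemma c1_u2_coprime : relatively_prime c1 u2.
Proof.
exact: (relatively_prime_dvdr u2_dvd_c2_exp (relatively_primeX _ c12)).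
Qed.

(** Conversely, [c2] divides the numerator, which is a product of powers of
    [c1] and [u2] modulo [c2], and [c1] can be cancelled. *)
Lemma c2_dvd_u2_exp : exists k, divides c2 (u2 ^+ k).
Proof.
exists (d * d ^ n.-1)%N.
apply: (@Gauss_divides _ _ (c1 ^+ (d ^ n.-1))).
  exact/relatively_primeX/relatively_primeC.
have [q] := iter_num_mod_c2 c1 c2 d_gt1 u1 u2 n.-1.
rewrite iter_num_periodic => /eqP; rewrite subr_eq addrC -subr_eq.
move=> /eqP /esym; rewrite exprMn -exprM => ->.
rewrite -mulNr; apply: dividesD; last first.
  by apply: divides_mull; exists 1; rewrite mul1r.
rewrite -mulrA mulrC; apply/divides_mull/divides_exp.
by rewrite expn_gt0 d_gt0.
Qed.

Lemma u1_c2_coprime : relatively_prime u1 c2.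
Proof.
have [k c2u2] := c2_dvd_u2_exp.
exact: (relatively_prime_dvdr c2u2 (relatively_primeX _ u12)).
Qed.

(** [periodic_subring1] for the ideal generated by [c1] and [u1] in the ring of
    integers with [c2 * u2] inverted: some power of [c2 * u2] lies in the ideal
    generated by [c1] and [u1], while [c1] is comaximal to [c2 * u2]. *)
Lemma c1_u1_coprime : relatively_prime c1 u1.
Proof.
set w := c2 * u2.
pose A (x : K) := exists k a b, val w ^+ k * x = val (a * c1 + b * u1).
have [k [a [b]]] : A 1.
  apply: (periodic_subring1 _ _ d_gt1 n_gt1 _ _ per_u) => [x y|x y||].
  - move=> [k [a [b xE]]] [l [a' [b' yE]]].
    exists (k + l)%N, (w ^+ l * a + w ^+ k * a'), (w ^+ l * b + w ^+ k * b').
    rewrite exprD mulrDr -!mulrA (mulrCA _ _ x) xE yE.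
    by rewrite !(rmorphD, rmorphM, rmorphXn) /=; ring.
  - move=> [k [a [b xE]]] [l [a' [b' yE]]].
    exists (k + l)%N, (a * (a' * c1 + b' * u1)), (b * (a' * c1 + b' * u1)).
    rewrite exprD mulrACA xE yE.
    by rewrite !(rmorphD, rmorphM, rmorphXn) /=; ring.
  - exists 1%N, u2, 0; rewrite !(rmorphD, rmorphM, rmorph0) /=.
    by field; rewrite val_neq0.
  - exists 1%N, 0, c2; rewrite !(rmorphD, rmorphM, rmorph0) /=.
    by field; rewrite val_neq0.
rewrite mulr1 -rmorphXn => /val_inj wE.
have [a' [b' ab1]] : relatively_prime c1 (w ^+ k).
  by apply/relatively_primeX/relatively_primeM; last exact: c1_u2_coprime.
by exists (a' + b' * a), (b' * b); rewrite -ab1 wE; ring.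
Qed.

Lemma F0_quot_c1_coprime : relatively_prime (F0_quot d n c1 c2) c1.
Proof.
apply/relatively_primeC; rewrite -(prednK n_gt0) /=.
apply: (relatively_prime_subl _ (relatively_primeX (d ^ n.-1).-1 c12)).
rewrite addrK mulrC; apply/divides_mull/divides_exp.
by rewrite -subn1 subn_gt0.
Qed.

Lemma c1_dvd_subX : divides c1 (u1 ^+ (d ^ n - 1) - u2 ^+ (d ^ n - 1)).
Proof.
apply: (@Gauss_divides _ _ (c2 ^+ (d ^ n.-1) * u1)).
  apply: relatively_primeM; last exact: c1_u1_coprime.
  exact: relatively_primeX.
have [q] := iter_num_mod_c1y c1 c2 d_gt1 u1 u2 n.-1.
rewrite prednK // iter_num_periodic -{2}(prednK dn_gt0) exprS subn1 => qE.
exists (- q * u2 ^+ d).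
have -> : - q * u2 ^+ d * c1 = - (q * (c1 * u2 ^+ d)) by ring.
by rewrite -qE; ring.
Qed.

(** By [iter_num_mod_x], F0 * u2^(d^n) is [u1] times an element congruent,
    modulo [u1] since d > 1, to a product of powers of [c2] and [u2]. *)
Lemma valuation_F0 p : prime_of p -> u1 \in p ->
  valuation p (F0 d n (val c1) (val c2)) = valuation p (val u1).
Proof.
move=> p_prime u1p.
have c2Np := relatively_prime_notin p_prime u1_c2_coprime u1p.
have u2Np := relatively_prime_notin p_prime u12 u1p.
have [q] := iter_num_mod_x c1 c2 d_gt1 u1 u2 n.-1.
rewrite prednK // iter_num_periodic => qE.
apply: (@valuation_cross _ _ p_prime (u2 ^+ (d ^ n))
          (c2 ^+ (d ^ n.-1) * u2 ^+ (d ^ n).-1 - q * u1 ^+ d.-1)).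
- exact: prime_expN.
- apply/negP => tp.
  have: c2 ^+ (d ^ n.-1) * u2 ^+ (d ^ n).-1 \notin p.
    by apply: prime_mulN => //; apply: prime_expN.
  case/negP; rewrite -[X in X \in p](subrK (q * u1 ^+ d.-1)) addrC.
  apply: prime_addl => //; case: d d_gt1 => [|[|k]] // _.
  by rewrite exprS mulrC prime_mull.
rewrite F0_iter_num -!rmorphM; congr val.
by rewrite mulrBl -(mulrA q) -exprSr (prednK d_gt0) -qE; ring.
Qed.

End PeriodicPoint.

Theorem lemma4p9 (K : fieldExtType rat) (d n : nat) (c1 c2 u1 u2 : 'O_K) :
  (2 <= d)%N -> (1 < n)%N ->
  c2 != 0 -> relatively_prime c1 c2 ->
  u2 != 0 -> relatively_prime u1 u2 ->
  exact_period (unicritical d (val c1 / val c2)) n (val u1 / val u2) ->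
  [/\ (forall (p : {pred 'O_K}) (a : \bar int),
         prime_of p -> valuation p (val u1) = a -> (1%:E <= a)%E ->
         valuation p (F0 d n (val c1) (val c2)) = a)
      /\ exactly_divides u1 (F0 d n (val c1) (val c2)),
      relatively_prime c1 u1,
      exactly_divides u1 (val (F0_quot d n c1 c2))
      /\ relatively_prime (F0_quot d n c1 c2) c1
    & divides c1 (u1 ^+ (d ^ n - 1) - u2 ^+ (d ^ n - 1))].
Proof.
move=> d_gt1 n_gt1 c2N0 c12 u2N0 u12 per_u.
have vF0 := valuation_F0 d_gt1 n_gt1 c2N0 c12 u2N0 u12 per_u.
have c1u1 := c1_u1_coprime d_gt1 n_gt1 c2N0 c12 u2N0 u12 per_u.
split.
- by split=> [p a p_prime <- /(valuation_ge1 p_prime)|]; apply: vF0.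
- exact: c1u1.
- split=> [p p_prime u1p|]; last exact: F0_quot_c1_coprime.
  rewrite -vF0 //; have [[_ p1 _] _ _] := p_prime.
  have c1Np := relatively_prime_notin p_prime (relatively_primeC c1u1) u1p.
  apply: (valuation_cross p_prime c1Np p1).
  by rewrite rmorph1 mul1r val_mul_F0_quot ?rmorphM.
- exact: (c1_dvd_subX d_gt1 n_gt1 c2N0 c12 u2N0 u12 per_u).
Qed.
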